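(* For every $n$, the map $\eta:\mathcal S_n\to\mathcal M_n$ is a bijection, and for every $\sigma\in\mathcal S_n$ the path $M=\eta(\sigma)$ satisfies $$\mathrm{wt}(M)= a^{\mathsf{ile}(\sigma)} b^{\mathsf{nile}(\sigma)} c^{\mathsf{ie}(\sigma)-\mathsf{ile}(\sigma)} d^{\mathsf{nie}(\sigma)-\mathsf{nile}(\sigma)} f^{\mathsf{ilae}(\sigma)} g^{\mathsf{nilae}(\sigma)} h^{\mathsf{iae}(\sigma)-\mathsf{ilae}(\sigma)} \ell^{\mathsf{niae}(\sigma)-\mathsf{nilae}(\sigma)}\, p^{\mathsf{exc}(\sigma)-\mathsf{le}(\sigma)} r^{\mathsf{aexc}(\sigma)-\mathsf{lae}(\sigma)} s^{\mathsf{le}(\sigma)} t^{\mathsf{lae}(\sigma)} u^{\mathsf{fp}(\sigma)} w^{\mathsf{iefp}(\sigma)} .$$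
   Context: $[n]=\{1,\dots,n\}$ and $\mathcal S_n$ is the set of permutations of $[n]$. Here $a,b,c,d,f,g,h,\ell,p,r,s,t,u,w$ are commuting indeterminates. Labeled Motzkin paths. A Motzkin path of length $n$ is a lattice path with $n$ steps, each an upstep $(1,1)$, a level step $(1,0)$ or a downstep $(1,-1)$, starting at the origin, ending on the $x$-axis and never going below it. $\mathcal M_n$ is the set of Motzkin paths of length $n$ in which each step carries a label (a monomial) as follows, where $I_k=\{0,1,\dots,k-1\}$: upsteps from height $k-1$ to height $k\ge1$ have labels in $\{p\,c^id^{k-1-i}: i\in I_k\}$; downsteps from height $k$ to height $k-1$ have labels in $\{r\,h^i\ell^{k-1-i}: i\in I_k\}$; level steps at height $k\ge 0$ have labels in $\{u\,w^k\}\cup\{s\,a^ib^{k-1-i}: i\in I_k\}\cup\{t\,f^ig^{k-1-i}: i\in I_k\}$. The weight $\mathrm{wt}(M)$ of $M\in\mathcal M_n$ is the product of its labels. The map $\eta$. Let $\sigma\in\mathcal S_n$, $i\in[n]$. Call $i$ an excedance if $i<\sigma(i)$, an anti-excedance if $i>\sigma(i)$, a fixed point if $i=\sigma(i)$. An excedance $i$ is linked if $\sigma^{-1}(i)<i$, and an anti-excedance $i$ is linked if $\sigma^{-1}(i)>i$. Put $\mathsf{inve}_i(\sigma)=\#\{x\in[n]: x<i<\sigma(i)<\sigma(x)\}$, $\mathsf{ninve}_i(\sigma)=\#\{x\in[n]: x<i<\sigma(x)<\sigma(i)\}$, $\mathsf{inva}_i(\sigma)=\#\{x\in[n]: x>i>\sigma(i)>\sigma(x)\}$,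 $\mathsf{ninva}_i(\sigma)=\#\{x\in[n]: x>i>\sigma(x)>\sigma(i)\}$, $\mathsf{iefp}_i(\sigma)=\#\{x\in[n]: x<i<\sigma(x)\}$. The path $\eta(\sigma)$ starts at $(0,0)$ and, for $i=1,\dots,n$, its $i$-th step is: - a level step labeled $a^{\mathsf{inve}_i(\sigma)}b^{\mathsf{ninve}_i(\sigma)}s$ if $i$ is a linked excedance; - an upstep labeled $c^{\mathsf{inve}_i(\sigma)}d^{\mathsf{ninve}_i(\sigma)}p$ if $i$ is a non-linked excedance; - a level step labeled $f^{\mathsf{inva}_i(\sigma)}g^{\mathsf{ninva}_i(\sigma)}t$ if $i$ is a linked anti-excedance; - a downstep labeled $h^{\mathsf{inva}_i(\sigma)}\ell^{\mathsf{ninva}_i(\sigma)}r$ if $i$ is a non-linked anti-excedance; - a level step labeled $u\,w^{\mathsf{iefp}_i(\sigma)}$ if $i$ is a fixed point. Permutation statistics (indices $i$, and ordered pairs $(i,j)$, range over $[n]$): - $\mathsf{exc}(\sigma)=\#\{i: i<\sigma(i)\}$, $\mathsf{fp}(\sigma)=\#\{i:i=\sigma(i)\}$, $\mathsf{aexc}(\sigma)=\#\{i: i>\sigma(i)\}$; - $\mathsf{le}(\sigma)=\#\{i:\sigma^{-1}(i)<i<\sigma(i)\}$, $\mathsf{lae}(\sigma)=\#\{i:\sigma^{-1}(i)>i>\sigma(i)\}$; - $\mathsf{ie}(\sigma)=\#\{(i,j): i<j<\sigma(j)<\sigma(i)\}$, $\mathsf{ile}(\sigma)=\#\{(i,j):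 i<j<\sigma(j)<\sigma(i),\ \sigma^{-1}(j)<j\}$; - $\mathsf{nie}(\sigma)=\#\{(i,j): i<j<\sigma(i)<\sigma(j)\}$, $\mathsf{nile}(\sigma)=\#\{(i,j): i<j<\sigma(i)<\sigma(j),\ \sigma^{-1}(j)<j\}$; - $\mathsf{iae}(\sigma)=\#\{(i,j): j>i>\sigma(i)>\sigma(j)\}$, $\mathsf{ilae}(\sigma)=\#\{(i,j): j>i>\sigma(i)>\sigma(j),\ \sigma^{-1}(i)>i\}$; - $\mathsf{niae}(\sigma)=\#\{(i,j): j>i>\sigma(j)>\sigma(i)\}$, $\mathsf{nilae}(\sigma)=\#\{(i,j): j>i>\sigma(j)>\sigma(i),\ \sigma^{-1}(i)>i\}$; - $\mathsf{iefp}(\sigma)=\#\{(i,j): i<j=\sigma(j)<\sigma(i)\}$. *)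

(* Defs.v *)
From HB Require Import structures.
From mathcomp Require Import all_boot all_order all_fingroup all_algebra.
From mathcomp Require Import mpoly.

Set Implicit Arguments.
Unset Strict Implicit.
Unset Printing Implicit Defensive.

Import Order.TTheory GRing.Theory Num.Theory.

Local Open Scope ring_scope.

(* Monomials live in the polynomial ring over the integers in the 14 commuting
   indeterminates a, b, c, d, f, g, h, l, p, r, s, t, u, w, written Xa, ..., Xw. *)
Notation label := {mpoly int[14]}.

Definition Xa : label := 'X_(@Ordinal 14 0 isT).
Definition Xb : label := 'X_(@Ordinal 14 1 isT).
Definition Xc : label := 'X_(@Ordinal 14 2 isT).
Definition Xd : label := 'X_(@Ordinal 14 3 isT).
Definition Xf : label := 'X_(@Ordinal 14 4 isT).
Definition Xg : label := 'X_(@Ordinal 14 5 isT).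
Definition Xh : label := 'X_(@Ordinal 14 6 isT).
Definition Xl : label := 'X_(@Ordinal 14 7 isT).
Definition Xp : label := 'X_(@Ordinal 14 8 isT).
Definition Xr : label := 'X_(@Ordinal 14 9 isT).
Definition Xs : label := 'X_(@Ordinal 14 10 isT).
Definition Xt : label := 'X_(@Ordinal 14 11 isT).
Definition Xu : label := 'X_(@Ordinal 14 12 isT).
Definition Xw : label := 'X_(@Ordinal 14 13 isT).

Inductive step := Up | Level | Down.

Definition rise (e : step) : int :=
  match e with Up => 1 | Level => 0 | Down => -1 end.

Definition lpath (n : nat) : Type := n.-tuple (step * label).

(* Height of the path after its first j steps; the i-th step, i : 'I_n being
   counted from 0, starts at height [height M i]. *)
Definition height n (M : lpath n) (j : nat) : int :=
  \sum_(i < n | (i < j)%N) rise (tnth M i).1.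

(* The index i ranges over {0, ..., k-1}, so the subtraction in k - 1 - i is
   never truncated. *)
Definition up_labels (k : nat) : seq label :=
  [seq Xp * Xc ^+ i * Xd ^+ (k - 1 - i) | i : 'I_k].

Definition down_labels (k : nat) : seq label :=
  [seq Xr * Xh ^+ i * Xl ^+ (k - 1 - i) | i : 'I_k].

Definition level_labels (k : nat) : seq label :=
  [:: Xu * Xw ^+ k]
  ++ [seq Xs * Xa ^+ i * Xb ^+ (k - 1 - i) | i : 'I_k]
  ++ [seq Xt * Xf ^+ i * Xg ^+ (k - 1 - i) | i : 'I_k].

(* Here k is the height at which the step starts, so that an upstep goes from
   k to k.+1 and a downstep from k to k.-1. *)
Definition step_labels (e : step) (k : nat) : seq label :=
  match e with
  | Up => up_labels k.+1
  | Level => level_labels k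
  | Down => down_labels k
  end.

(* Once the heights are known to be nonnegative, the absolute value only casts
   them to nat. *)
Definition Motzkin (n : nat) : pred (lpath n) := fun M =>
  [&& [forall j : 'I_n.+1, 0 <= height M j],
      height M n == 0
    & [forall i : 'I_n,
         (tnth M i).2 \in step_labels (tnth M i).1 `|height M i|%N]].

Definition wt n (M : lpath n) : label :=
  \prod_(i < n) (tnth M i).2.

(* Permutations of {1, ..., n} are represented as permutations of
   'I_n = {0, ..., n-1}; all notions below depend only on the order of the
   indices, which the shift preserves. *)
Section Eta.

Variables (n : nat) (sigma : 'S_n).

Let inv (i : 'I_n) : 'I_n := (sigma^-1)%g i.

Definition inve_at (i : 'I_n) : nat :=
  #|[set x : 'I_n | [&& x < i, i < sigma i & sigma i < sigma x]%N]|.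
Definition ninve_at (i : 'I_n) : nat :=
  #|[set x : 'I_n | [&& x < i, i < sigma x & sigma x < sigma i]%N]|.
Definition inva_at (i : 'I_n) : nat :=
  #|[set x : 'I_n | [&& x > i, i > sigma i & sigma i > sigma x]%N]|.
Definition ninva_at (i : 'I_n) : nat :=
  #|[set x : 'I_n | [&& x > i, i > sigma x & sigma x > sigma i]%N]|.
Definition iefp_at (i : 'I_n) : nat :=
  #|[set x : 'I_n | (x < i)%N && (i < sigma x)%N]|.

Definition eta_step (i : 'I_n) : step * label :=
  if (i < sigma i)%N then
    if (inv i < i)%N
    then (Level, Xa ^+ inve_at i * Xb ^+ ninve_at i * Xs)
    else (Up, Xc ^+ inve_at i * Xd ^+ ninve_at i * Xp)
  else if (i > sigma i)%N then
    if (inv i > i)%N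
    then (Level, Xf ^+ inva_at i * Xg ^+ ninva_at i * Xt)
    else (Down, Xh ^+ inva_at i * Xl ^+ ninva_at i * Xr)
  else (Level, Xu * Xw ^+ iefp_at i).

Definition eta : lpath n := [tuple eta_step i | i < n].

Definition exc : nat := #|[set i : 'I_n | (i < sigma i)%N]|.
Definition fp : nat := #|[set i : 'I_n | i == sigma i]|.
Definition aexc : nat := #|[set i : 'I_n | (i > sigma i)%N]|.

Definition le : nat := #|[set i : 'I_n | (inv i < i)%N && (i < sigma i)%N]|.
Definition lae : nat := #|[set i : 'I_n | (inv i > i)%N && (i > sigma i)%N]|.

Definition ie : nat :=
  #|[set ij : 'I_n * 'I_n | let: (i, j) := ij in
      [&& i < j, j < sigma j & sigma j < sigma i]%N]|.
Definition ile : nat :=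
  #|[set ij : 'I_n * 'I_n | let: (i, j) := ij in
      [&& i < j, j < sigma j, sigma j < sigma i & inv j < j]%N]|.
Definition nie : nat :=
  #|[set ij : 'I_n * 'I_n | let: (i, j) := ij in
      [&& i < j, j < sigma i & sigma i < sigma j]%N]|.
Definition nile : nat :=
  #|[set ij : 'I_n * 'I_n | let: (i, j) := ij in
      [&& i < j, j < sigma i, sigma i < sigma j & inv j < j]%N]|.
Definition iae : nat :=
  #|[set ij : 'I_n * 'I_n | let: (i, j) := ij in
      [&& j > i, i > sigma i & sigma i > sigma j]%N]|.
Definition ilae : nat :=
  #|[set ij : 'I_n * 'I_n | let: (i, j) := ij in
      [&& j > i, i > sigma i, sigma i > sigma j & inv i > i]%N]|.
Definition niae : nat :=
  #|[set ij : 'I_n * 'I_n | let: (i, j) := ij in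
      [&& j > i, i > sigma j & sigma j > sigma i]%N]|.
Definition nilae : nat :=
  #|[set ij : 'I_n * 'I_n | let: (i, j) := ij in
      [&& j > i, i > sigma j, sigma j > sigma i & inv i > i]%N]|.
Definition iefp : nat :=
  #|[set ij : 'I_n * 'I_n | let: (i, j) := ij in
      [&& i < j, j == sigma j & j < sigma i]%N]|.

End Eta.

(* Main.v *)
Require Import Defs.
From mathcomp Require Import all_boot all_order all_fingroup all_algebra.
From mathcomp Require Import mpoly.
From mathcomp Require Import zify.

(** Call i an excedance value if it is the image of a smaller index. The type of
    the i-th step of eta(sigma) records whether i is an excedance and whether it
    is an excedance value (dually for anti-excedances), so that the height
    before that step is #{x : x < i <= sigma(x)} = #{x : sigma(x) < i <= x}.
    Assign images to the excedances from the largest index down: inve_i is the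
    number of values above sigma(i) among the excedance values larger than i
    that are still unused, and there are inve_i + ninve_i + 1 such values. So
    the step types and the inve_i determine sigma on the excedances, and every
    choice of codes below the number of available values, which is what the
    labels of a Motzkin path allow, is realized. Anti-excedances are the same
    statement for the opposite order of the indices, and the two partial maps
    glue with the identity on the fixed points into a permutation. *)

Set Implicit Arguments.
Unset Strict Implicit.
Unset Printing Implicit Defensive.

Local Open Scope ring_scope.
Import GRing.Theory.

(** * Codes of increasing partial maps on a finite strict total order *)

Section Codes.

Variables (T : finType) (r : rel T).
Hypotheses (r_irr : irreflexive r) (r_trans : transitive r)
  (r_total : forall x y, x != y -> r x y || r y x).

Lemma r_asym x y : r x y -> r y x = false.
Proof. by move=> xy; apply/negP => /(r_trans xy); rewrite r_irr. Qed.

Lemma exists_min (W : {set T}) x0 :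
  x0 \in W -> exists2 x, x \in W & forall y, y \in W -> y != x -> r x y.
Proof.
move=> Wx0; case: (arg_minnP (fun x => #|[set y | r y x]|) Wx0) => x Wx xmin.
exists x => // y Wy nyx; case/orP: (r_total nyx) => // yx.
have := xmin y Wy; rewrite leqNgt proper_card //; apply/properP; split.
  by apply/subsetP => z; rewrite !inE => zy; apply: r_trans yx.
by exists y; rewrite !inE ?r_irr.
Qed.

(** The least element of [W] has all the others above it and serves the largest [c]. Smaller [c] are
    found after deleting it, which changes no count because it lies above nothing in [W]. *)
Lemma rank_exists (W : {set T}) c : (c < #|W|)%N ->
  exists2 v, v \in W & #|[set u in W | r v u]| = c.
Proof.
have [m] := ubnP #|W|; elim: m W c => // m IH W c; rewrite ltnS => Wm cW.
have [x0 Wx0] : exists x, x \in W by apply/set0Pn; rewrite -card_gt0; lia.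
have [x Wx xmin] := exists_min Wx0.
have cWx := cardsD1 x W; rewrite Wx /= in cWx.
have [cE|cN] := eqVneq c #|W :\ x|.
  exists x => //; rewrite cE; apply: eq_card => u; rewrite !inE.
  case: eqVneq => [->|nux]; first by rewrite r_irr andbF.
  by case Wu: (u \in W); rewrite //= xmin.
have [||v Wv <-] := IH (W :\ x) c; [lia | lia |].
exists v; first by case/setD1P: Wv.
apply: eq_card => u; rewrite !inE; case: eqVneq => [->|//].
by case/setD1P: Wv => nvx Wv; rewrite (r_asym (xmin _ Wv nvx)) andbF.
Qed.

Lemma rank_inj (W : {set T}) v v' : v \in W -> v' \in W ->
  #|[set u in W | r v u]| = #|[set u in W | r v' u]| -> v = v'.
Proof.
have lt u u' : u' \in W -> r u u' ->
    (#|[set x in W | r u' x]| < #|[set x in W | r u x]|)%N.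
  move=> Wu' uu'; apply: proper_card; apply/properP; split.
    apply/subsetP => z; rewrite !inE => /andP[-> u'z]; exact: r_trans u'z.
  by exists u'; rewrite !inE Wu' ?r_irr.
move=> Wv Wv' E; apply/eqP/negPn/negP => /r_total /orP[] /lt.
  by move=> /(_ Wv'); rewrite E ltnn.
by move=> /(_ Wv); rewrite E ltnn.
Qed.

Variables (P V : {set T}).

(** Only images of points above [i] are removed, so this set depends on [f] above [i] alone; this
    permits recursion from the top down. *)
Definition avail (f : T -> T) i : {set T} :=
  [set v in V | r i v & v \notin f @: [set y in P | r i y]].

(* f maps P into V, increasing every point for r; running through P from its
   r-greatest element down, f i has c i still unused values above it. *)
Definition coded (f : T -> T) (c : T -> nat) : Prop :=
  forall i, i \in P ->
    f i \in avail f i /\ #|[set v in avail f i | r (f i) v]| = c i.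

Lemma coded_inj f c : coded f c -> {in P &, injective f}.
Proof.
move=> fc.
have neq x y : x \in P -> y \in P -> r x y -> f x != f y.
  move=> Px Py xy; have [+ _] := fc _ Px; rewrite !inE => /and3P[_ _].
  by apply: contra => /eqP->; apply: imset_f; rewrite inE Py.
move=> x y Px Py fE; apply/eqP/negPn/negP => /r_total /orP[] /neq.
  by move=> /(_ Px Py); rewrite fE eqxx.
by move=> /(_ Py Px); rewrite fE eqxx.
Qed.

(** Induction on the number of points above [i]: agreement there makes the two available sets equal,
    and the rank [c i] in that set determines the value. *)
Lemma coded_uniq f g c : coded f c -> coded g c -> {in P, f =1 g}.
Proof.
move=> fc gc i; have [m] := ubnP #|[set y | r i y]|.
elim: m i => // m IH i; rewrite ltnS => im Pi.
have E : avail f i = avail g i.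
  rewrite /avail; suff -> : f @: [set y in P | r i y] =
    g @: [set y in P | r i y] by [].
  apply: eq_in_imset => y; rewrite inE => /andP[Py iy]; apply: IH => //.
  apply: leq_trans im; apply: proper_card; apply/properP; split.
    by apply/subsetP => z; rewrite !inE; apply: r_trans.
  by exists y; rewrite !inE ?r_irr.
have [fi fci] := fc _ Pi; have [gi gci] := gc _ Pi.
rewrite -E in gi gci; by apply: rank_inj fi gi _; rewrite fci gci.
Qed.

End Codes.

Section CodesExist.

Variables (T : finType) (r : rel T).
Hypotheses (r_irr : irreflexive r) (r_trans : transitive r)
  (r_total : forall x y, x != y -> r x y || r y x).

(** Induction on [P], removing its least element [x]: its value is chosen last and affects no other
    available set, since [x] is above no point of [P]. *)
Lemma coded_exists (P V : {set T}) (c : T -> nat) :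
  (forall i, i \in P ->
     c i + #|[set y in P | r i y]| < #|[set v in V | r i v]|)%N ->
  exists f, coded r P V f c.
Proof.
have [m] := ubnP #|P|; elim: m P => // m IH P; rewrite ltnS => Pm cP.
have [->|/set0Pn[x0 Px0]] := eqVneq P set0.
  by exists id => i; rewrite inE.
have [x Px xmin] := exists_min r_irr r_trans r_total Px0.
have cPx := cardsD1 x P; rewrite Px /= in cPx.
have above i : i \in P -> [set y in P :\ x | r i y] = [set y in P | r i y].
  move=> Pi; apply/setP => y; rewrite !inE; case: eqVneq => //= ->.
  have [->|nix] := eqVneq i x; first by rewrite r_irr andbF.
  by rewrite (r_asym r_irr r_trans (xmin _ Pi nix)) andbF.
have [||f fc] := IH (P :\ x); first by lia.
  by move=> i /setD1P[_ Pi]; rewrite above //; apply: cP.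
(* The points above [x] use up at most their own number of values, so more than [c x] values stay
   free. *)
have [|v Wv vc] := @rank_exists _ _ r_irr r_trans r_total (avail r P V f x) (c x).
  have := cP x Px; have: (#|f @: [set y in P | r x y]| <= #|[set y in P | r x y]|)%N.
    exact: leq_imset_card.
  have -> : avail r P V f x =
      [set v in V | r x v] :\: f @: [set y in P | r x y].
    by apply/setP => v; rewrite !inE andbA [LHS]andbC.
  rewrite cardsD.
  have := subset_leq_card (subsetIr [set v in V | r x v] (f @: [set y in P | r x y])).
  lia.
exists [eta f with x |-> v] => i Pi.
have E : avail r P V [eta f with x |-> v] i = avail r (P :\ x) V f i.
  rewrite /avail above //.
  suff -> : [eta f with x |-> v] @: [set y in P | r i y] =
            f @: [set y in P | r i y] by [].
  apply: eq_in_imset => y /=; rewrite inE => /andP[Py iy]; case: eqVneq => // yx.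
  have [ix|nix] := eqVneq i x; first by rewrite ix yx r_irr in iy.
  by rewrite yx (r_asym r_irr r_trans (xmin _ Pi nix)) in iy.
rewrite E /=; case: eqVneq => [->|nix]; last by apply: fc; rewrite !inE nix.
have -> : avail r (P :\ x) V f x = avail r P V f x by rewrite /avail above.
by [].
Qed.

(** Write a value above [s i] as [s x]. It is free exactly when [x] is not above [i]; as [x] is not
    [i] either, [x] lies below [i]. For the usual order this count is [inve_at], for the opposite
    one [inva_at]. *)
Lemma perm_coded (s : {perm T}) :
  coded r [set i | r i (s i)] [set i | r ((s^-1)%g i) i] s
    (fun i => #|[set x | [&& r x i, r i (s i) & r (s i) (s x)]]|).
Proof.
move=> i; rewrite inE => Pi; split.
  rewrite !inE permK Pi /=; apply/imsetP => -[y]; rewrite !inE => /andP[_ iy].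
  by move=> /perm_inj E; rewrite E r_irr in iy.
rewrite -[RHS](card_imset _ (@perm_inj _ s)); apply: eq_card => v.
rewrite -[v](permKV s); set x := (s^-1)%g v; rewrite mem_imset; last exact: perm_inj.
rewrite !inE permK mem_imset; last exact: perm_inj.
rewrite !inE Pi /=.
have [sisx|] := boolP (r (s i) (s x)); last by rewrite !andbF.
have isx := r_trans Pi sisx; rewrite isx !andbT /=.
have [xi|/negbTE nxi] := boolP (r x i).
  by rewrite (r_trans xi isx) (r_asym r_irr r_trans xi) andbF.
have [E|/r_total] := eqVneq x i; first by rewrite E r_irr in sisx.
by rewrite nxi /= => ->; rewrite andbT andbN.
Qed.

End CodesExist.

(** * Cardinalities as sums of indicators *)

Lemma card_setE (T : finType) (Q : pred T) :
  #|[set x | Q x]| = (\sum_x (Q x : nat))%N.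
Proof.
rewrite -sum1_card big_mkcond; apply: eq_bigr => x _.
by rewrite inE; case: (Q x).
Qed.

Lemma sum_pred1 (T : finType) (x0 : T) (Q : pred T) :
  (\sum_x ((x == x0) && Q x : nat))%N = Q x0.
Proof.
rewrite (bigD1 x0) //= eqxx big1 ?addn0 // => x /negbTE->.
by [].
Qed.

Lemma sum_perm (T : finType) (s : {perm T}) (F : T -> nat) :
  (\sum_x F (s x) = \sum_x F x)%N.
Proof. by rewrite [RHS](reindex_inj (@perm_inj _ s)). Qed.

(** * Step kinds, and labels as pairs of a kind and a code *)

Inductive kind := KUp | KLinkedExc | KFix | KLinkedAexc | KDown.

(* The label of a step starting at height k that has code x. *)
Definition kstep (kd : kind) (k x : nat) : step * label :=
  match kd with
  | KUp => (Up, Xp * Xc ^+ x * Xd ^+ (k - x))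
  | KLinkedExc => (Level, Xs * Xa ^+ x * Xb ^+ (k - 1 - x))
  | KFix => (Level, Xu * Xw ^+ k)
  | KLinkedAexc => (Level, Xt * Xf ^+ x * Xg ^+ (k - 1 - x))
  | KDown => (Down, Xr * Xh ^+ x * Xl ^+ (k - 1 - x))
  end.

(* The number of codes available at height k; a fixed point has the code 0. *)
Definition kbound (kd : kind) (k : nat) : nat :=
  match kd with KUp => k.+1 | KFix => 1 | _ => k end.

(** The suffix [pos] refers to the arc leaving an index of this kind, [val] to the arc entering it.
    The four truth values together determine the kind. *)
Definition exc_pos kd :=
  match kd with KUp | KLinkedExc => true | _ => false end.
Definition exc_val kd :=
  match kd with KLinkedExc | KDown => true | _ => false end.
Definition aexc_pos kd :=
  match kd with KLinkedAexc | KDown => true | _ => false end.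
Definition aexc_val kd :=
  match kd with KUp | KLinkedAexc => true | _ => false end.

Lemma step_labelsP e k (m : label) :
  reflect (exists kd x, (x < kbound kd k)%N /\ (e, m) = kstep kd k x)
    (m \in step_labels e k).
Proof.
apply: (iffP idP).
  case: e => /=.
  - by case/mapP => i _ ->; exists KUp, i; rewrite subn1.
  - rewrite inE mem_cat => /or3P[/eqP->|/mapP[i _ ->]|/mapP[i _ ->]].
    + by exists KFix, 0.
    + by exists KLinkedExc, i.
    + by exists KLinkedAexc, i.
  - by case/mapP => i _ ->; exists KDown, i.
case=> -[] [x [/= xk [-> ->]]] /=.
- apply/mapP; exists (Ordinal xk); rewrite ?mem_enum //=; by rewrite subn1.
- by rewrite inE mem_cat; apply/or3P/Or32/mapP; exists (Ordinal xk); rewrite ?mem_enum.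
- by rewrite inE eqxx.
- by rewrite inE mem_cat; apply/or3P/Or33/mapP; exists (Ordinal xk); rewrite ?mem_enum.
- by apply/mapP; exists (Ordinal xk); rewrite ?mem_enum.
Qed.

(* Evaluating the j-th indeterminate at 2 and the others at 1 reads off
   exponents of monomials. *)
Definition mark (j : 'I_14) (m : label) : int :=
  m.@[fun i => if i == j then 2 else 1].

Ltac eval_marks :=
  rewrite /mark /kstep /Xa /Xb /Xc /Xd /Xf /Xg /Xh /Xl /Xp /Xr /Xs /Xt /Xu /Xw
    [LHS]/= !(mevalM, rmorphXn) /= !mevalXU /= ?(expr1n, mulr1, mul1r).

Lemma mark_s kd k x : mark (@Ordinal 14 10 isT) (kstep kd k x).2 =
  if kd is KLinkedExc then 2 else 1.
Proof.
by case: kd; eval_marks.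
Qed.

Lemma mark_t kd k x : mark (@Ordinal 14 11 isT) (kstep kd k x).2 =
  if kd is KLinkedAexc then 2 else 1.
Proof.
by case: kd; eval_marks.
Qed.

(** No variable carries the code of a fixed point; [Xu], of exponent 1, is a placeholder. *)
Definition code_var kd : 'I_14 :=
  match kd with
  | KUp => @Ordinal 14 2 isT
  | KLinkedExc => @Ordinal 14 0 isT
  | KLinkedAexc => @Ordinal 14 4 isT
  | KDown => @Ordinal 14 6 isT
  | KFix => @Ordinal 14 12 isT
  end.

Lemma mark_code kd k x : mark (code_var kd) (kstep kd k x).2 =
  2 ^+ (if kd is KFix then 1 else x).
Proof.
by case: kd; eval_marks.
Qed.

(** The step type and the exponents of [Xs] and [Xt] separate the kinds. The code is then read off
    as an exponent, except at a fixed point, where the bound forces it to be 0. *)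
Lemma kstep_inj k kd kd' x x' : (x < kbound kd k)%N -> (x' < kbound kd' k)%N ->
  kstep kd k x = kstep kd' k x' -> kd = kd' /\ x = x'.
Proof.
move=> xk xk' E.
have kdE : kd = kd'.
  have := f_equal fst E.
  have := f_equal (fun e => mark (@Ordinal 14 10 isT) e.2) E; rewrite /= !mark_s.
  have := f_equal (fun e => mark (@Ordinal 14 11 isT) e.2) E; rewrite /= !mark_t.
  by clear; case: kd; case: kd'.
split=> //; subst kd'.
have := f_equal (fun e => mark (code_var kd) e.2) E; rewrite /= !mark_code.
move/(Num.Theory.ieexprIn (isT : 0 < 2 :> int) isT).
by case: kd xk xk' {E} => //= xk xk' _; lia.
Qed.

(** * Kinds, codes and open arcs of a permutation *)

Section Permutation.

Variables (n : nat) (s : 'S_n).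
Implicit Types (i : 'I_n) (j : nat).

(** The upward arcs from [x] to [s x] open just before [j], those ending at [j] included; this will
    be the height of the path. *)
Definition cross j : nat := #|[set x : 'I_n | (x < j <= s x)%N]|.

Definition kind_of i : kind :=
  if (i < s i)%N then if ((s^-1)%g i < i)%N then KLinkedExc else KUp
  else if (s i < i)%N then if (i < (s^-1)%g i)%N then KLinkedAexc else KDown
  else KFix.

(** Fixed points fall in the second branch, where [inva_at] is 0. *)
Definition code i : nat := if (i < s i)%N then inve_at s i else inva_at s i.

Lemma perm_inv_eq i x : (x == (s^-1)%g i) = (s x == i).
Proof. by rewrite (can2_eq (permK s) (permKV s)). Qed.

Lemma kind_ofP i :
  [/\ exc_pos (kind_of i) = (i < s i)%N,
      exc_val (kind_of i) = ((s^-1)%g i < i)%N,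
      aexc_pos (kind_of i) = (s i < i)%N
    & aexc_val (kind_of i) = (i < (s^-1)%g i)%N].
Proof.
have := perm_inv_eq i i; rewrite /kind_of -!val_eqE /=.
by case: (ltngtP i (s i)); case: (ltngtP i ((s^-1)%g i)).
Qed.

Lemma kind_ofE i kd : exc_pos kd = (i < s i)%N ->
  exc_val kd = ((s^-1)%g i < i)%N -> aexc_pos kd = (s i < i)%N ->
  aexc_val kd = (i < (s^-1)%g i)%N -> kind_of i = kd.
Proof.
have [<- <- <- <-] := kind_ofP i.
by case: (kind_of i); case: kd.
Qed.

(** As many [x] satisfy [s x < j] as [x < j]; discarding those that satisfy both leaves the two
    sides. *)
Lemma cross_sym j : cross j = #|[set x : 'I_n | (s x < j <= x)%N]|.
Proof.
rewrite /cross !card_setE; apply/eqP.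
rewrite -(eqn_add2l (\sum_x ((s x < j)%N : nat))).
rewrite {2}(sum_perm s (fun x : 'I_n => (x < j)%N : nat)) -!big_split /=.
by apply/eqP/eq_bigr => x _; lia.
Qed.

(** An arc open at [i] ends above [s i], strictly between [i] and [s i], or at [i]; the last case
    occurs when the preimage of [i] is smaller. *)
Lemma cross_exc i : (i < s i)%N ->
  (inve_at s i + ninve_at s i + ((s^-1)%g i < i) = cross i)%N.
Proof.
move=> isi; rewrite /inve_at /ninve_at /cross !card_setE.
rewrite -(sum_pred1 ((s^-1)%g i) (fun x => (x < i)%N)) -!big_split /=.
apply: eq_bigr => x _; rewrite perm_inv_eq isi /= -!val_eqE /=.
have : (s x == s i :> nat) = (x == i :> nat) by rewrite !val_eqE (inj_eq perm_inj).
by case: (ltngtP x i); case: (ltngtP i (s x)); case: (ltngtP (s i) (s x)); lia.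
Qed.

(** Count downward arcs by [cross_sym]: the arc leaving [i] gives the 1, and the others start above
    [i] and are sorted by whether they end below or above [s i]. *)
Lemma cross_aexc i : (s i < i)%N ->
  (inva_at s i + ninva_at s i + 1 = cross i)%N.
Proof.
move=> isi; rewrite /inva_at /ninva_at cross_sym !card_setE.
rewrite -[1%N](sum_pred1 i predT) -!big_split /=.
apply: eq_bigr => x _; rewrite isi /= -!val_eqE /=.
have : (s x == s i :> nat) = (x == i :> nat) by rewrite !val_eqE (inj_eq perm_inj).
by case: (ltngtP x i); case: (ltngtP i (s x)); case: (ltngtP (s i) (s x)); lia.
Qed.

Lemma cross_fix i : s i = i -> iefp_at s i = cross i.
Proof.
move=> sii; rewrite /iefp_at /cross; apply: eq_card => x; rewrite !inE.
have : (s x == i :> nat) = (x == i :> nat).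
  by rewrite !val_eqE -{1}sii (inj_eq perm_inj).
by case: (ltngtP x i); case: (ltngtP i (s x)).
Qed.

(** Given the height, [ninve_at] and [ninva_at] are complementary to the code, so a label carries a
    single number. *)
Lemma eta_stepE i : eta_step s i = kstep (kind_of i) (cross i) (code i).
Proof.
rewrite /eta_step /kind_of /code.
case: ltngtP => [isi|sii|/val_inj/esym sii].
- have := cross_exc isi.
  by case: ifP => _ <- /=; rewrite mulrC mulrA; congr (_, _ * _ ^+ _); lia.
- have := cross_aexc sii.
  by case: ifP => _ <- /=; rewrite mulrC mulrA; congr (_, _ * _ ^+ _); lia.
- by rewrite /= cross_fix.
Qed.

Lemma code_bound i : (code i < kbound (kind_of i) (cross i))%N.
Proof.
rewrite /kind_of /code; case: (ltngtP i (s i)) => [isi|sii|/val_inj/esym sii].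
- by have := cross_exc isi; case: ifP => _ /=; lia.
- by have := cross_aexc sii; case: ifP => _ /=; lia.
- rewrite /= ltnS leqn0 cards_eq0; apply/eqP/setP => x.
  by rewrite !inE sii ltnn andbF.
Qed.

End Permutation.

(** * Heights of the image path *)

Lemma rise_kstep kd k x :
  rise (kstep kd k x).1 = (exc_pos kd)%:Z - (exc_val kd)%:Z.
Proof. by case: kd. Qed.

Lemma rise_kstep_aexc kd k x :
  rise (kstep kd k x).1 = (aexc_val kd)%:Z - (aexc_pos kd)%:Z.
Proof. by case: kd. Qed.

Lemma tnth_eta n (s : 'S_n) i : tnth (eta s) i = eta_step s i.
Proof. exact: tnth_mktuple. Qed.

(** Abstract in [p] and [v] because heights are counted in two ways: excedance positions minus
    values, and anti-excedance values minus positions. *)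
Lemma height_diff n (M : lpath n) (p v : pred 'I_n) :
  (forall i, rise (tnth M i).1 = (p i)%:Z - (v i)%:Z) ->
  forall j, height M j = #|[set i | p i & (i < j)%N]|%:Z
                         - #|[set i | v i & (i < j)%N]|%:Z.
Proof.
move=> riseE j; rewrite /height big_mkcond !card_setE.
rewrite !(big_morph Posz PoszD (erefl (0%N : int))) -sumrB.
by apply: eq_bigr => i _; rewrite riseE; case: ltnP => _; rewrite ?andbT ?andbF ?subrr.
Qed.

(** The excedance arcs begun before [j], minus those ended before [j], are the open ones. *)
Lemma height_eta n (s : 'S_n) j : height (eta s) j = cross s j.
Proof.
rewrite (height_diff (p := fun i => (i < s i)%N)
                     (v := fun i => ((s^-1)%g i < i)%N)); last first.
  move=> i; have [<- <- _ _] := kind_ofP s i.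
  by rewrite tnth_eta eta_stepE rise_kstep.
apply/eqP; rewrite subr_eq -PoszD eqz_nat /cross !card_setE.
rewrite -(sum_perm s (fun i : 'I_n => ((s^-1)%g i < i)%N && (i < j)%N : nat)).
by rewrite -big_split /=; apply/eqP/eq_bigr => x _; rewrite permK; lia.
Qed.

Lemma eta_Motzkin n (s : 'S_n) : Motzkin (eta s).
Proof.
apply/and3P; split.
- by apply/forallP => j; rewrite height_eta.
- rewrite height_eta eqz_nat cards_eq0; apply/eqP/setP => x.
  by rewrite !inE; have := ltn_ord (s x); lia.
- apply/forallP => i; rewrite height_eta absz_nat tnth_eta eta_stepE.
  apply/step_labelsP; exists (kind_of s i), (code s i).
  by rewrite code_bound -surjective_pairing.
Qed.

(** * Injectivity, through the two opposite orders of the indices *)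

Section Orders.

Variable n : nat.

Definition ord_lt : rel 'I_n := fun x y => (x < y)%N.
Definition ord_gt : rel 'I_n := fun x y => (y < x)%N.

Lemma ord_lt_irr : irreflexive ord_lt. Proof. by move=> x; apply: ltnn. Qed.
Lemma ord_gt_irr : irreflexive ord_gt. Proof. by move=> x; apply: ltnn. Qed.
Lemma ord_lt_trans : transitive ord_lt. Proof. by move=> y x z; apply: ltn_trans. Qed.
Lemma ord_gt_trans : transitive ord_gt.
Proof. by move=> y x z yx zy; apply: ltn_trans zy yx. Qed.
Lemma ord_lt_total x y : x != y -> ord_lt x y || ord_lt y x.
Proof. by rewrite -neq_ltn. Qed.
Lemma ord_gt_total x y : x != y -> ord_gt x y || ord_gt y x.
Proof. by rewrite orbC -neq_ltn. Qed.

Lemma exc_coded (s : 'S_n) :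
  coded ord_lt [set i : 'I_n | (i < s i)%N] [set i : 'I_n | ((s^-1)%g i < i)%N] s
    (inve_at s).
Proof. exact: perm_coded ord_lt_irr ord_lt_trans ord_lt_total s. Qed.

Lemma aexc_coded (s : 'S_n) :
  coded ord_gt [set i : 'I_n | (s i < i)%N] [set i : 'I_n | (i < (s^-1)%g i)%N] s
    (inva_at s).
Proof. exact: perm_coded ord_gt_irr ord_gt_trans ord_gt_total s. Qed.

End Orders.

Lemma coded_eq (T : finType) (r : rel T) (P V P' V' : {set T}) f f' c c' :
  P =i P' -> V =i V' -> {in P, f =1 f'} -> {in P, c =1 c'} ->
  coded r P V f c -> coded r P' V' f' c'.
Proof.
move=> /setP <- /setP <- fE cE fc i Pi; have [fi fci] := fc i Pi.
have <- : avail r P V f i = avail r P V f' i.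
  rewrite /avail; suff -> : f @: [set y in P | r i y] =
    f' @: [set y in P | r i y] by [].
  by apply: eq_in_imset => y; rewrite inE => /andP[/fE].
by rewrite -fE // -cE.
Qed.

(** The kinds fix the position and value sets for both orders, so [coded_uniq] applies to excedances
    and to anti-excedances; all other points are fixed. *)
Lemma kind_code_inj n (s s' : 'S_n) :
  kind_of s =1 kind_of s' -> code s =1 code s' -> s = s'.
Proof.
move=> kE cE; apply/permP => i.
have E (x : 'I_n) : [/\ (x < s x)%N = (x < s' x)%N,
  ((s^-1)%g x < x)%N = ((s'^-1)%g x < x)%N, (s x < x)%N = (s' x < x)%N
  & (x < (s^-1)%g x)%N = (x < (s'^-1)%g x)%N].
  by have [<- <- <- <-] := kind_ofP s x;
    have [<- <- <- <-] := kind_ofP s' x; rewrite kE.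
have [iE _ aE _] := E i; have := iE; have := aE.
case: (ltngtP i (s i)) => [isi _ /esym is'i|sii /esym s'ii _|/val_inj sii].
- have H :=
    coded_uniq (@ord_lt_irr n) (@ord_lt_trans n) (@ord_lt_total n) (@exc_coded n s).
  apply: H; last by rewrite inE.
  apply: coded_eq (@exc_coded n s') => [x|x|//|x]; rewrite !inE.
  + by have [-> _ _ _] := E x.
  + by have [_ -> _ _] := E x.
  + by move=> xs'x; have := cE x; rewrite /code xs'x;
      have [-> _ _ _] := E x; rewrite xs'x.
- have H :=
    coded_uniq (@ord_gt_irr n) (@ord_gt_trans n) (@ord_gt_total n) (@aexc_coded n s).
  apply: H; last by rewrite inE.
  apply: coded_eq (@aexc_coded n s') => [x|x|//|x]; rewrite !inE.
  + by have [_ _ -> _] := E x.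
  + by have [_ _ _ ->] := E x.
  + move=> s'xx; have := cE x; rewrite /code; have [-> _ _ _] := E x.
    by rewrite ltnNge (ltnW s'xx).
- by case: (ltngtP i (s' i)) => // /val_inj <-.
Qed.

(** Equal paths have equal heights, and at a known height [kstep_inj] recovers kind and code from
    each step. *)
Lemma eta_inj n : injective (fun s : 'S_n => eta s).
Proof.
move=> s s' E.
have kc i : kind_of s i = kind_of s' i /\ code s i = code s' i.
  have cE : cross s i = cross s' i.
    by have := height_eta s i; rewrite E height_eta => -[].
  have := code_bound s i; rewrite cE => b; apply: kstep_inj b (code_bound s' i) _.
  by rewrite -{1}cE -!eta_stepE -!tnth_eta E.
by apply: kind_code_inj => i; have [] := kc i.
Qed.

(** * Gluing two coded maps into a permutation with prescribed kinds and codes *)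

Section Realization.

Variables (n : nat) (kd : 'I_n -> kind) (f g : 'I_n -> 'I_n) (x : 'I_n -> nat).
Let P := [set i | exc_pos (kd i)].
Let V := [set i | exc_val (kd i)].
Let A := [set i | aexc_pos (kd i)].
Let B := [set i | aexc_val (kd i)].
Hypotheses (fc : coded (@ord_lt n) P V f x) (gc : coded (@ord_gt n) A B g x).

Definition glue (i : 'I_n) : 'I_n :=
  if exc_pos (kd i) then f i else if aexc_pos (kd i) then g i else i.

Variant glue_spec i : kind -> 'I_n -> Prop :=
  | GlueExc k : exc_pos k -> exc_val (kd (f i)) -> (i < f i)%N ->
      i \in P -> glue_spec i k (f i)
  | GlueAexc k : aexc_pos k -> aexc_val (kd (g i)) -> (g i < i)%N ->
      i \in A -> glue_spec i k (g i)
  | GlueFix : kd i = KFix -> glue_spec i KFix i.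

Lemma glueP i : glue_spec i (kd i) (glue i).
Proof.
rewrite /glue; case: ifP => Pi.
  have iP : i \in P by rewrite inE.
  have [+ _] := fc iP; rewrite !inE => /and3P[Vfi ifi _].
  exact: GlueExc.
case: ifP => Ai.
  have iA : i \in A by rewrite inE.
  have [+ _] := gc iA; rewrite !inE => /and3P[Bgi gii _].
  exact: GlueAexc.
have kdi : kd i = KFix by case: (kd i) Pi Ai.
by rewrite [X in glue_spec _ X]kdi; apply: GlueFix.
Qed.

(** Images under [f] have an [exc_val] kind, images under [g] an [aexc_val] kind, and fixed points
    neither; no kind is both. *)
Lemma glue_inj : injective glue.
Proof.
have fI := coded_inj (@ord_lt_total n) fc.
have gI := coded_inj (@ord_gt_total n) gc.
move=> i j; case: (glueP i) => [k _ Vi _ Pi|k _ Bi _ Ai|Fi];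
  case: (glueP j) => [k' _ Vj _ Pj|k' _ Bj _ Aj|Fj] E //.
- exact: fI.
- by move: Vi Bj; rewrite E; case: (kd _).
- by move: Vi; rewrite E Fj.
- by move: Bi Vj; rewrite E; case: (kd _).
- exact: gI.
- by move: Bi; rewrite E Fj.
- by move: Vj; rewrite -E Fi.
- by move: Bj; rewrite -E Fi.
Qed.

Definition glue_perm : 'S_n := perm glue_inj.

(** The arc leaving [i] is read at [i]; the arc entering [i] is read at its preimage [z]. *)
Lemma kind_glue i : kind_of glue_perm i = kd i.
Proof.
apply: kind_ofE.
- rewrite permE; case: glueP => [k -> _ ->|k + _ gii|] //; last by rewrite ltnn.
  by rewrite ltnNge (ltnW gii); case: k.
- rewrite -{1 3}[i](permKV glue_perm).
  set z := (glue_perm^-1)%g i; rewrite permE.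
  case: glueP => [k _ -> ->|k _ + gzz _|->] //.
    by rewrite ltnNge (ltnW gzz); case: (kd _).
  by rewrite ltnn.
- rewrite permE; case: glueP => [k + _ ifi|k -> _ ->|] //; last by rewrite ltnn.
  by rewrite ltnNge (ltnW ifi); case: k.
- rewrite -{1 2}[i](permKV glue_perm).
  set z := (glue_perm^-1)%g i; rewrite permE.
  case: glueP => [k _ + zfz _|k _ -> ->|->] //.
    by rewrite ltnNge (ltnW zfz); case: (kd _).
  by rewrite ltnn.
Qed.

Lemma glueE_exc : {in P, f =1 glue_perm}.
Proof. by move=> i; rewrite inE permE /glue => ->. Qed.

Lemma glueE_aexc : {in A, g =1 glue_perm}.
Proof. by move=> i; rewrite inE permE /glue; case: (kd i). Qed.

(** Both numbers count the same free values above the image of [i]. Fixed points lie outside [P] and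
    [A], so there [x] is prescribed to be 0. *)
Lemma code_glue i : (kd i = KFix -> x i = 0%N) -> code glue_perm i = x i.
Proof.
move=> xfix; have kE j := kind_ofP glue_perm j.
have [iP _ iA _] := kE i; rewrite kind_glue in iP iA.
rewrite /code -iP; case: ifP => Pi.
  have fc' : coded (@ord_lt n) [set i : 'I_n | (i < glue_perm i)%N]
      [set i : 'I_n | ((glue_perm^-1)%g i < i)%N] glue_perm x.
    apply: coded_eq fc => // [j|j|]; last exact: glueE_exc.
      by have [E _ _ _] := kE j; rewrite !inE -E kind_glue.
    by have [_ E _ _] := kE j; rewrite !inE -E kind_glue.
  have si : i \in [set i : 'I_n | (i < glue_perm i)%N] by rewrite inE -iP.
  by have [_ <-] := fc' i si; have [_ <-] := @exc_coded n glue_perm i si.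
case: (boolP (aexc_pos (kd i))) => Ai.
  have gc' : coded (@ord_gt n) [set i : 'I_n | (glue_perm i < i)%N]
      [set i : 'I_n | (i < (glue_perm^-1)%g i)%N] glue_perm x.
    apply: coded_eq gc => // [j|j|]; last exact: glueE_aexc.
      by have [_ _ E _] := kE j; rewrite !inE -E kind_glue.
    by have [_ _ _ E] := kE j; rewrite !inE -E kind_glue.
  have si : i \in [set i : 'I_n | (glue_perm i < i)%N] by rewrite inE -iA.
  by have [_ <-] := gc' i si; have [_ <-] := @aexc_coded n glue_perm i si.
have Fi : kd i = KFix by case: (kd i) Pi Ai.
have := code_bound glue_perm i; rewrite kind_glue Fi xfix // /code -iP Pi.
by case: inva_at.
Qed.

End Realization.

(** * Surjectivity *)

Lemma card_split n (p : pred 'I_n) (j : 'I_n) :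
  #|[set i | p i]| =
    (#|[set i | p i & (i < j)%N]| + p j + #|[set i | p i & (j < i)%N]|)%N.
Proof.
rewrite !card_setE -(sum_pred1 j p) -!big_split /=; apply: eq_bigr => i _.
by rewrite -val_eqE /=; case: ltngtP; case: (p i).
Qed.

Lemma eta_surj n (M : lpath n) : Motzkin M -> exists s : 'S_n, eta s = M.
Proof.
case/and3P => /forallP hM /eqP hMn /forallP lM.
have {lM} : forall i : 'I_n, exists kx : kind * nat,
    (kx.2 < kbound kx.1 `|height M i|)%N /\
    tnth M i = kstep kx.1 `|height M i| kx.2.
  move=> i; have /step_labelsP[kd [x [xb E]]] := lM i.
  by exists (kd, x); rewrite -E -surjective_pairing.
case/fin_all_exists => kx kxM.
pose kd (i : 'I_n) := (kx i).1; pose x (i : 'I_n) := (kx i).2.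
have hi (i : 'I_n) : height M i = `|height M i|%N.
  by rewrite gez0_abs //; have := hM (widen_ord (leqnSn n) i).
have hE := height_diff (M := M) (p := fun i => exc_pos (kd i))
                     (v := fun i => exc_val (kd i)).
have hA := height_diff (M := M) (p := fun i => aexc_val (kd i))
                     (v := fun i => aexc_pos (kd i)).
have {}hE := hE (fun i => etrans (f_equal (fun e => rise e.1) (kxM i).2)
                            (rise_kstep _ _ _)).
have {}hA := hA (fun i => etrans (f_equal (fun e => rise e.1) (kxM i).2)
                            (rise_kstep_aexc _ _ _)).
(* Final height 0 balances positions and values, so counts after [i] can be traded for counts before
   [i]. *)
have PV : #|[set i | exc_pos (kd i)]| = #|[set i | exc_val (kd i)]|.
  move: (hE n); rewrite hMn => /esym/eqP; rewrite subr_eq0 eqz_nat => /eqP E.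
  by move: E; congr (_ = _); apply: eq_card => i; rewrite !inE ltn_ord andbT.
have [|f fc] := coded_exists (@ord_lt_irr n) (@ord_lt_trans n) (@ord_lt_total n)
    (P := [set i | exc_pos (kd i)]) (V := [set i | exc_val (kd i)]) (c := x).
  move=> i; rewrite inE => iP.
  have -> : [set y in [set i | exc_pos (kd i)] | ord_lt i y] =
            [set y | exc_pos (kd y) & (i < y)%N] by apply/setP => y; rewrite !inE.
  have -> : [set y in [set i | exc_val (kd i)] | ord_lt i y] =
            [set y | exc_val (kd y) & (i < y)%N] by apply/setP => y; rewrite !inE.
  (* Values after [i] exceed positions after [i] by the height plus 1 minus [exc_val (kd i)], which
     is [kbound] for both excedance kinds. *)
  move: PV (hE i) (kxM i).1.
  rewrite (card_split (fun i => exc_pos (kd i)) i) (card_split (fun i => exc_val (kd i)) i).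
  rewrite hi /= -/(x i) -/(kd i) iP; case: (kd i) iP => //= _; lia.
have [|g gc] := coded_exists (@ord_gt_irr n) (@ord_gt_trans n) (@ord_gt_total n)
    (P := [set i | aexc_pos (kd i)]) (V := [set i | aexc_val (kd i)]) (c := x).
  move=> i; rewrite inE => iP.
  have -> : [set y in [set i | aexc_pos (kd i)] | ord_gt i y] =
            [set y | aexc_pos (kd y) & (y < i)%N] by apply/setP => y; rewrite !inE.
  have -> : [set y in [set i | aexc_val (kd i)] | ord_gt i y] =
            [set y | aexc_val (kd y) & (y < i)%N] by apply/setP => y; rewrite !inE.
  (* In the opposite order the points above [i] are the smaller indices, where values exceed
     positions by exactly the height. *)
  move: (hA i) (kxM i).1.
  rewrite hi /= -/(x i) -/(kd i); case: (kd i) iP => //= _; lia.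
exists (glue_perm fc gc); apply: eq_from_tnth => i.
rewrite tnth_eta eta_stepE kind_glue code_glue; last first.
  by move=> kdi; have [+ _] := kxM i; rewrite -/(kd i) kdi -/(x i) /=; case: (x i).
rewrite (kxM i).2 -/(kd i) -/(x i); congr kstep.
(* Both heights are the same difference of counts, since the kinds agree at every step. *)
apply/eqP; rewrite -eqz_nat -hi -height_eta hE.
rewrite (height_diff (p := fun i => exc_pos (kd i))
                     (v := fun i => exc_val (kd i))) //.
by move=> j; rewrite tnth_eta eta_stepE kind_glue rise_kstep.
Qed.

(** * Statistics as sums over the steps, and the weight *)

Lemma card_pairl (I J : finType) (Q : I -> J -> bool) :
  #|[set ij : I * J | let: (i, j) := ij in Q i j]| = (\sum_i #|[set j | Q i j]|)%N.
Proof.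
rewrite card_setE (eq_bigr (fun ij : I * J => Q ij.1 ij.2 : nat)) => [|[i j] //].
rewrite -(pair_bigA _ (fun i j => Q i j : nat)) /=.
by apply: eq_bigr => i _; rewrite card_setE.
Qed.

Lemma card_pairr (I J : finType) (Q : I -> J -> bool) :
  #|[set ij : I * J | let: (i, j) := ij in Q i j]| = (\sum_j #|[set i | Q i j]|)%N.
Proof.
rewrite card_pairl (eq_bigr _ (fun i _ => card_setE (Q i))) exchange_big /=.
by apply: eq_bigr => j _; rewrite card_setE.
Qed.

Lemma mul_card (T : finType) (b : bool) (Q : pred T) :
  (b * #|[set x | Q x]|)%N = #|[set x | b && Q x]|.
Proof.
case: b; rewrite ?mul1n // mul0n; apply/esym/eqP; rewrite cards_eq0.
by apply/eqP/setP => x; rewrite !inE.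
Qed.

Section Weight.

Variables (n : nat) (s : 'S_n).
Let inv (i : 'I_n) : 'I_n := (s^-1)%g i.

(** One product covers all five cases, so exponents can be summed over the steps. The counts
    [inve_at] and [ninve_at] vanish off excedances, [inva_at] and [ninva_at] off anti-excedances, so
    only linkedness needs an indicator there. *)
Lemma eta_step_label i : (eta_step s i).2 =
    Xa ^+ ((inv i < i) * inve_at s i)%N * Xb ^+ ((inv i < i) * ninve_at s i)%N
  * Xc ^+ (~~ (inv i < i) * inve_at s i)%N * Xd ^+ (~~ (inv i < i) * ninve_at s i)%N
  * Xf ^+ ((i < inv i) * inva_at s i)%N * Xg ^+ ((i < inv i) * ninva_at s i)%N
  * Xh ^+ (~~ (i < inv i) * inva_at s i)%N * Xl ^+ (~~ (i < inv i) * ninva_at s i)%N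
  * Xp ^+ (~~ (inv i < i) && (i < s i))%N * Xr ^+ (~~ (i < inv i) && (s i < i))%N
  * Xs ^+ ((inv i < i) && (i < s i))%N * Xt ^+ ((i < inv i) && (s i < i))%N
  * Xu ^+ (i == s i) * Xw ^+ ((i == s i) * iefp_at s i)%N.
Proof.
have empty (Q : pred 'I_n) : (forall x, Q x = false) -> #|[set x | Q x]| = 0%N.
  by move=> Q0; apply/eqP; rewrite cards_eq0; apply/eqP/setP => x; rewrite !inE.
have inve0 : (s i <= i)%N -> inve_at s i = 0%N.
  by move=> sii; apply: empty => x; lia.
have ninve0 : (s i <= i)%N -> ninve_at s i = 0%N.
  by move=> sii; apply: empty => x; lia.
have inva0 : (i <= s i)%N -> inva_at s i = 0%N.
  by move=> sii; apply: empty => x; lia.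
have ninva0 : (i <= s i)%N -> ninva_at s i = 0%N.
  by move=> sii; apply: empty => x; lia.
rewrite /eta_step -/(inv i) -val_eqE /=.
move: (inve_at s i) (ninve_at s i) (inva_at s i) (ninva_at s i) (iefp_at s i)
  inve0 ninve0 inva0 ninva0 => x y z t e x0 y0 z0 t0.
move: Xa Xb Xc Xd Xf Xg Xh Xl Xp Xr Xs Xt Xu Xw; do 14!move=> ?.
have mul1s (R : nzRingType) (u v w : R) :
    u * v * w = u * v * 1 * 1 * 1 * 1 * 1 * 1 * 1 * 1 * w * 1 * 1 * 1.
  by rewrite !mulr1.
have mul1u (R : nzRingType) (u v : R) :
    u * v = 1 * 1 * 1 * 1 * 1 * 1 * 1 * 1 * 1 * 1 * 1 * 1 * u * v.
  by rewrite !mul1r.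
have mulE := (mul0n, mul1n, muln0, andbF, andbT, expr0, expr1).
case: ltngtP x0 y0 z0 t0 => _ x0 y0 z0 t0.
- rewrite z0 ?t0 // !mulE; case: ifP => _; rewrite /= !mulE.
    exact: mul1s.
  by rewrite !(mulr1, mul1r).
- rewrite x0 ?y0 // !mulE; by case: ifP => _; rewrite /= !mulE !(mulr1, mul1r).
- by rewrite x0 ?y0 ?z0 ?t0 // !mulE; exact: mul1u.
Qed.

(** [lem] selects the coordinate that is the step index: the second for excedances and fixed points,
    the first for anti-excedances. *)
Ltac sum_pairs lem :=
  rewrite /ile /nile /ilae /nilae /ie /nie /iae /niae /iefp lem;
  apply: eq_bigr => j _;
  rewrite /inve_at /ninve_at /inva_at /ninva_at /iefp_at ?mul_card;
  apply: eq_card => i; rewrite !inE.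

Lemma ileE : ile s = (\sum_(i < n) (inv i < i) * inve_at s i)%N.
Proof. by sum_pairs @card_pairr; rewrite [RHS]andbC -!andbA. Qed.

(** Summing [inve_at] over all indices gives [ie]; the linked part is at most the whole in each
    term, so subtraction is exact termwise. *)
Lemma ie_ileE : (ie s - ile s = \sum_(i < n) ~~ (inv i < i) * inve_at s i)%N.
Proof.
suff -> : ie s = (\sum_(i < n) inve_at s i)%N.
  rewrite ileE -sumnB => [|i _]; last by case: (inv i < i)%N; lia.
  by apply: eq_bigr => i _; case: (inv i < i)%N; lia.
by sum_pairs @card_pairr.
Qed.

Lemma nileE : nile s = (\sum_(i < n) (inv i < i) * ninve_at s i)%N.
Proof. by sum_pairs @card_pairr; rewrite [RHS]andbC -!andbA. Qed.

Lemma nie_nileE : (nie s - nile s = \sum_(i < n) ~~ (inv i < i) * ninve_at s i)%N.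
Proof.
suff -> : nie s = (\sum_(i < n) ninve_at s i)%N.
  rewrite nileE -sumnB => [|i _]; last by case: (inv i < i)%N; lia.
  by apply: eq_bigr => i _; case: (inv i < i)%N; lia.
by sum_pairs @card_pairr.
Qed.

Lemma ilaeE : ilae s = (\sum_(i < n) (i < inv i) * inva_at s i)%N.
Proof. by sum_pairs @card_pairl; rewrite [RHS]andbC -!andbA. Qed.

Lemma iae_ilaeE : (iae s - ilae s = \sum_(i < n) ~~ (i < inv i) * inva_at s i)%N.
Proof.
suff -> : iae s = (\sum_(i < n) inva_at s i)%N.
  rewrite ilaeE -sumnB => [|i _]; last by case: (i < inv i)%N; lia.
  by apply: eq_bigr => i _; case: (i < inv i)%N; lia.
by sum_pairs @card_pairl.
Qed.

Lemma nilaeE : nilae s = (\sum_(i < n) (i < inv i) * ninva_at s i)%N.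
Proof. by sum_pairs @card_pairl; rewrite [RHS]andbC -!andbA. Qed.

Lemma niae_nilaeE : (niae s - nilae s = \sum_(i < n) ~~ (i < inv i) * ninva_at s i)%N.
Proof.
suff -> : niae s = (\sum_(i < n) ninva_at s i)%N.
  rewrite nilaeE -sumnB => [|i _]; last by case: (i < inv i)%N; lia.
  by apply: eq_bigr => i _; case: (i < inv i)%N; lia.
by sum_pairs @card_pairl.
Qed.

Lemma leE : le s = (\sum_(i < n) ((inv i < i) && (i < s i)))%N.
Proof. exact: card_setE. Qed.

Lemma exc_leE : (exc s - le s = \sum_(i < n) (~~ (inv i < i) && (i < s i)))%N.
Proof.
rewrite /exc card_setE leE -sumnB => [|i _]; last by case: (inv i < i)%N; lia.
by apply: eq_bigr => i _; case: (inv i < i)%N; case: (i < s i)%N.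
Qed.

Lemma laeE : lae s = (\sum_(i < n) ((i < inv i) && (s i < i)))%N.
Proof. exact: card_setE. Qed.

Lemma aexc_laeE : (aexc s - lae s = \sum_(i < n) (~~ (i < inv i) && (s i < i)))%N.
Proof.
rewrite /aexc card_setE laeE -sumnB => [|i _]; last by case: (i < inv i)%N; lia.
by apply: eq_bigr => i _; case: (i < inv i)%N; case: (s i < i)%N.
Qed.

Lemma iefpE : iefp s = (\sum_(i < n) (i == s i) * iefp_at s i)%N.
Proof. by sum_pairs @card_pairr; rewrite andbCA. Qed.

Lemma wt_eta :
  wt (eta s) =
    Xa ^+ ile s * Xb ^+ nile s * Xc ^+ (ie s - ile s) * Xd ^+ (nie s - nile s)
  * Xf ^+ ilae s * Xg ^+ nilae s
  * Xh ^+ (iae s - ilae s) * Xl ^+ (niae s - nilae s)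
  * Xp ^+ (exc s - le s) * Xr ^+ (aexc s - lae s)
  * Xs ^+ le s * Xt ^+ lae s * Xu ^+ fp s * Xw ^+ iefp s.
Proof.
rewrite ie_ileE nie_nileE iae_ilaeE niae_nilaeE exc_leE aexc_laeE.
rewrite ileE nileE ilaeE nilaeE leE laeE iefpE /fp card_setE.
rewrite -!prodrXr -!big_split /=.
by apply: eq_bigr => i _; rewrite tnth_eta eta_step_label.
Qed.

End Weight.

(* In each exponent difference the subtracted statistic counts a subset of
   what the first one counts, so natural-number subtraction is exact. *)
Theorem theorem3 (n : nat) :
  [/\ forall sigma : 'S_n, Motzkin (eta sigma),
      injective (fun sigma : 'S_n => eta sigma),
      forall M : lpath n, Motzkin M -> exists sigma : 'S_n, eta sigma = M
    & forall sigma : 'S_n,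
      wt (eta sigma) =
        Xa ^+ ile sigma * Xb ^+ nile sigma
        * Xc ^+ (ie sigma - ile sigma) * Xd ^+ (nie sigma - nile sigma)
        * Xf ^+ ilae sigma * Xg ^+ nilae sigma
        * Xh ^+ (iae sigma - ilae sigma) * Xl ^+ (niae sigma - nilae sigma)
        * Xp ^+ (exc sigma - le sigma) * Xr ^+ (aexc sigma - lae sigma)
        * Xs ^+ le sigma * Xt ^+ lae sigma
        * Xu ^+ fp sigma * Xw ^+ iefp sigma].
Proof.
split; [exact: eta_Motzkin | exact: eta_inj | exact: eta_surj | exact: wt_eta].
Qed.
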